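(* Let $\gamma$ be a circular relative equilibrium (RE) for the planar Newtonian $n$-body problem (in $\mathbb{R}^2$), and let $B_3$ be the associated $(4n-8)\times(4n-8)$ symmetric matrix. If $$n^-\big(B_3|_{\ker (JB_3)^{4n-8}}\big)-n^-(B_3)\equiv 1\pmod 2,$$ then $\gamma$ is spectrally unstable. In particular, if $JB_3$ has no non-trivial Jordan blocks corresponding to the zero eigenvalue and $$n^-(B_3)\equiv 1\pmod 2,$$ then $\gamma$ is spectrally unstable.
   Context: Planar Newtonian setting: $n\ge 3$ bodies with positions $q_i\in\mathbb{R}^2$ and masses $m_i>0$; $M=\mathrm{diag}(m_1I_2,\dots,m_nI_2)$; $U(q)=\sum_{i<j} m_im_j/|q_i-q_j|$; the equation of motion is $M\ddot q=\nabla U(q)$. $D^2U(q)$ is the Euclidean Hessian. A (normalized) central configuration is $q\in\mathbb{R}^{2n}$ with $q_i\neq q_j$ for $i\ne j$, $\sum_i m_iq_i=0$, $\langle Mq,q\rangle=1$ and $\nabla U(q)+U(q)Mq=0$. Put $k=\sqrt{U(q)}$, $J_2=\begin{pmatrix}0&-1\\1&0\end{pmatrix}$ and let $K=\mathrm{diag}(kJ_2,\dots,kJ_2)$ ($2n\times 2n$). The circular relative equilibrium generated by $q$ is $\gamma(t)=e^{tK}q$. In rotating coordinates the linearized Hamiltonian system along $\gamma$ is $\dot z=Lz$ on $\mathbb{R}^{4n}$ with $L=\begin{pmatrix}K&M^{-1}\\ D^2U(q)&K\end{pmatrix}$. In every even dimension $J=\begin{pmatrix}0&-I\\ I&0\end{pmatrix}$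 is the standard complex structure and $\omega_0(x,y)=\langle Jx,y\rangle$. Let $E_1=\{(v,\dots,v,m_1w,\dots,m_nw): v,w\in\mathbb{R}^2\}$, $E_2=\mathrm{span}\{(q,0),(Kq,0),(0,Mq),(0,MKq)\}$, and let $E_3$ be the $\omega_0$-orthogonal complement of $E_1\oplus E_2$ in $\mathbb{R}^{4n}$ (the Meyer–Schmidt decomposition). These are $L$-invariant symplectic subspaces and $\dim E_3=4n-8$. $B_3:=JL_3$, where $L_3$ is the matrix of $L|_{E_3}$ in a symplectic basis of $E_3$; $B_3$ is symmetric, and the choice of symplectic basis is irrelevant for what follows. $n^-(B)$ is the number of negative eigenvalues of a symmetric matrix $B$, and $n^-(B|_V)$ is the index of the quadratic form $\langle B\cdot,\cdot\rangle$ restricted to a subspace $V$. $\gamma$ is spectrally stable if all eigenvalues of $JB_3$ are purely imaginary (zero allowed), and spectrally unstable otherwise. *)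

(* Defs.v *)
From HB Require Import structures.
From mathcomp Require Export all_boot all_order all_algebra.
From mathcomp Require Export polyrcf complex.
From mathcomp Require Export all_classical all_reals all_analysis.
Export numFieldNormedType.Exports.
Export Order.TTheory GRing.Theory Num.Theory.

Set Implicit Arguments.
Unset Strict Implicit.
Unset Printing Implicit Defensive.

Local Open Scope classical_set_scope.
Local Open Scope ring_scope.

Section LinearAlgebra.
Variable R : realType.

Definition dot p (x y : 'cV[R]_p) : R := (x^T *m y) 0 0.

(* The norm [`|x|] of a matrix in the library is the sup norm. *)
Definition enorm p (x : 'cV[R]_p) : R := Num.sqrt (dot x x).

Definition Jstd p : 'M[R]_(p + p) := block_mx 0 (- 1%:M) 1%:M 0.

Definition omega0 p (x y : 'cV[R]_(p + p)) : R := dot (Jstd p *m x) y.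

(* The exponential series, taken entrywise. *)
Definition expmx p (A : 'M[R]_p) : 'M[R]_p :=
  \matrix_(i, j) limn (series (fun k => (k`!)%:R^-1 * (A ^+ k) i j)).

Definition kermx_col p (A : 'M[R]_p) : {vspace 'cV[R]_p} :=
  lker (linfun (mulmx A)).

(* Number of negative eigenvalues, with multiplicity. *)
Definition nminus p (B : 'M[R]_p) : nat :=
  (\sum_(x <- rootsR (char_poly B) | (x < 0)%R) mup x (char_poly B))%N.

Definition negative_definite_on p (B : 'M[R]_p) (W : {vspace 'cV[R]_p}) : Prop :=
  forall x, x \in W -> x != 0 -> dot (B *m x) x < 0.

(* Index of the quadratic form <Bx, x> on V: the largest dimension of a
   subspace of V on which the form is negative definite. *)
Definition nminus_on p (B : 'M[R]_p) (V : {vspace 'cV[R]_p}) : nat :=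
  (\max_(k < (\dim V).+1 |
     `[< exists W : {vspace 'cV[R]_p},
           [/\ (W <= V)%VS, \dim W = k & negative_definite_on B W] >]) k)%N.

Definition complexify p (A : 'M[R]_p) : 'M[R[i]]_p :=
  map_mx (real_complex R) A.

Definition jordan_block (a : R[i]) s : 'M[R[i]]_s :=
  \matrix_(i, j) (a *+ (i == j) + (i.+1 == j :> nat)%:R).

(* [P] is invertible and [P^-1 A P] is the block diagonal matrix of the Jordan
   blocks; [P] is formally rectangular because the sum of the block sizes is
   only propositionally equal to [p]. *)
Definition is_jordan_form p (A : 'M[R[i]]_p) r (a : 'I_r -> R[i])
    (s : 'I_r -> nat) : Prop :=
  (forall i, (0 < s i)%N) /\
  exists P : 'M[R[i]]_(p, \sum_i s i),
    [/\ row_free P, row_full P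
      & A *m P = P *m \mxdiag_(i < r) jordan_block (a i) (s i)].

Definition no_nontrivial_zero_jordan_block p (A : 'M[R]_p) : Prop :=
  exists r (a : 'I_r -> R[i]) (s : 'I_r -> nat),
    is_jordan_form (complexify A) a s /\ (forall i, a i = 0 -> s i = 1%N).

End LinearAlgebra.

Section NBody.
Variables (R : realType) (n : nat) (m : 'I_n -> R).

(* Dimension 2n of the configuration space, as a sum of n blocks of size 2 so
   that the block operations \mxcol, \mxdiag, submxcol apply. *)
Definition cdim : nat := (\sum_(i < n) 2)%N.
Local Notation conf := 'cV[R]_cdim.
Local Notation phase := 'cV[R]_(cdim + cdim).

Definition pos (q : conf) (i : 'I_n) : 'cV[R]_2 :=
  @submxcol R n (fun=> 2%N) 1 q i.

Definition mkconf (x : 'I_n -> 'cV[R]_2) : conf :=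
  @mxcol R n (fun=> 2%N) 1 x.

Definition blockdiag (A : 'I_n -> 'M[R]_2) : 'M[R]_cdim :=
  @mxdiag R n (fun=> 2%N) A.

Definition mass_mx : 'M[R]_cdim := blockdiag (fun i => m i *: 1%:M).

Definition potential (q : conf) : R :=
  \sum_(i < n) \sum_(j < n | (i < j)%N) m i * m j / enorm (pos q i - pos q j).

(* Partial derivative in the direction of a basis vector; a one-variable
   derivative, as 'cV_p is a normed space in the library only when p is
   syntactically a successor. *)
Definition partial (f : conf -> R) (a : 'I_cdim) (q : conf) : R :=
  derive1 (fun t : R => f (q + t *: delta_mx a 0)) 0.

Definition grad (f : conf -> R) (q : conf) : conf :=
  \col_a partial f a q.

Definition hess (f : conf -> R) (q : conf) : 'M[R]_cdim :=
  \matrix_(a, b) partial (partial f b) a q.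

Definition central_configuration (q : conf) : Prop :=
  [/\ forall i j, i != j -> pos q i != pos q j,
      \sum_(i < n) m i *: pos q i = 0,
      dot (mass_mx *m q) q = 1
    & grad potential q + potential q *: (mass_mx *m q) = 0].

(* ((0, -1), (1, 0)) *)
Definition J2 : 'M[R]_2 := \matrix_(i, j) ((j < i)%N%:R - (i < j)%N%:R).

Definition K_mx (q : conf) : 'M[R]_cdim :=
  blockdiag (fun=> Num.sqrt (potential q) *: J2).

Definition is_circular_RE (q : conf) (gamma : R -> conf) : Prop :=
  central_configuration q /\ forall t, gamma t = expmx (t *: K_mx q) *m q.

Definition L_mx (q : conf) : 'M[R]_(cdim + cdim) :=
  block_mx (K_mx q) (invmx mass_mx) (hess potential q) (K_mx q).

Definition E1 : set phase :=
  [set z | exists v w : 'cV[R]_2,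
     z = col_mx (mkconf (fun=> v)) (mkconf (fun i => m i *: w))].

Definition E2 (q : conf) : set phase :=
  [set z | z \in <<[:: col_mx q 0; col_mx (K_mx q *m q) 0;
                       col_mx 0 (mass_mx *m q);
                       col_mx 0 (mass_mx *m K_mx q *m q)]>>%VS].

Definition E3 (q : conf) : set phase :=
  [set z | forall x y, E1 x -> E2 q y -> omega0 (x + y) z = 0].

(* Half the dimension 4n - 8 of E3. *)
Definition hdim : nat := (2 * n - 4)%N.

(* The columns of [S] form a basis of [E], i.e. c |-> S c is a bijection onto
   [E], and [omega0] has its standard matrix in this basis. *)
Definition symplectic_basis p (E : set phase)
    (S : 'M[R]_(cdim + cdim, p + p)) : Prop :=
  set_bij [set: 'cV[R]_(p + p)] E (mulmx S) /\
  S^T *m Jstd R cdim *m S = Jstd R p.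

(* [B = J L3], where [L3] is the matrix of L|_E3 in a symplectic basis. *)
Definition is_B3 (q : conf) (B : 'M[R]_(hdim + hdim)) : Prop :=
  exists (S : 'M[R]_(cdim + cdim, hdim + hdim)) (L3 : 'M[R]_(hdim + hdim)),
    [/\ symplectic_basis (E3 q) S, L_mx q *m S = S *m L3
      & B = Jstd R hdim *m L3].

Definition spectrally_stable (gamma : R -> conf) : Prop :=
  forall q (B : 'M[R]_(hdim + hdim)), is_circular_RE q gamma -> is_B3 q B ->
  forall z : R[i],
    eigenvalue (complexify (Jstd R hdim *m B)) z -> complex.Re z = 0.

Definition spectrally_unstable (gamma : R -> conf) : Prop :=
  ~ spectrally_stable gamma.

End NBody.

(* Main.v *)
(* Let A = J B with B = B3, and suppose that the spectrum of A is imaginary.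
   The Fitting decomposition R^p = V0 + V1 into the generalized kernel
   V0 = ker A^p and V1 = im A^p is orthogonal for both omega and B, because
   omega(A x, y) = - omega(x, A y).  Hence n^-(B) = n^-(B|V0) + n^-(B|V1).  In a
   basis of V1 the matrix of B is W A1 with W antisymmetric and A1 the matrix of
   A, both invertible.  A real matrix without negative eigenvalue has
   nonnegative determinant, which applies to W and to A1; so det (B|V1) > 0 and
   n^-(B|V1) is even.  If moreover the zero eigenvalue of A is semisimple, then
   V0 = ker A = ker B and n^-(B|V0) = 0.  The symmetry of B comes from that of
   the Hessian of U. *)
Require Import Defs.
From mathcomp Require Import ring lra zify.

Set Implicit Arguments.
Unset Strict Implicit.
Unset Printing Implicit Defensive.

Local Open Scope ring_scope.

(** * Spectral theorem for real symmetric matrices *)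

Section Euclid.
Variable R : realType.

Lemma dotC p (x y : 'cV[R]_p) : dot x y = dot y x.
Proof. by rewrite /dot -[in LHS](trmxK y) -trmx_mul mxE. Qed.

Lemma dot_mulmxl p k (A : 'M[R]_(k, p)) x y : dot (A *m x) y = dot x (A^T *m y).
Proof. by rewrite /dot trmx_mul mulmxA. Qed.

Lemma dotE p (x y : 'cV[R]_p) : dot x y = \sum_i x i 0 * y i 0.
Proof. by rewrite /dot mxE; apply: eq_bigr => i _; rewrite !mxE. Qed.

Lemma dotDl p (x y z : 'cV[R]_p) : dot (x + y) z = dot x z + dot y z.
Proof. by rewrite /dot raddfD mulmxDl mxE. Qed.

Lemma dotDr p (x y z : 'cV[R]_p) : dot z (x + y) = dot z x + dot z y.
Proof. by rewrite !(dotC z) dotDl. Qed.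

Lemma dotZl p a (x y : 'cV[R]_p) : dot (a *: x) y = a * dot x y.
Proof. by rewrite /dot linearZ -scalemxAl mxE. Qed.

Lemma dotZr p a (x y : 'cV[R]_p) : dot y (a *: x) = a * dot y x.
Proof. by rewrite !(dotC y) dotZl. Qed.

Lemma dotNl p (x y : 'cV[R]_p) : dot (- x) y = - dot x y.
Proof. by rewrite -scaleN1r dotZl mulN1r. Qed.

Lemma dotNr p (x y : 'cV[R]_p) : dot y (- x) = - dot y x.
Proof. by rewrite !(dotC y) dotNl. Qed.

Lemma dot0l p (y : 'cV[R]_p) : dot 0 y = 0.
Proof. by rewrite -(scale0r 0) dotZl mul0r. Qed.

Lemma dot_ge0 p (x : 'cV[R]_p) : 0 <= dot x x.
Proof. by rewrite dotE sumr_ge0 // => i _; rewrite -expr2 sqr_ge0. Qed.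

Lemma dot_eq0 p (x : 'cV[R]_p) : (dot x x == 0) = (x == 0).
Proof.
apply/eqP/eqP => [|->]; last by rewrite dot0l.
rewrite dotE => /psumr_eq0P h; apply/matrixP => i j; rewrite ord1 mxE.
have /eqP := h (fun i _ => sqr_ge0 (x i 0)) i isT.
by rewrite mulf_eq0 orbb => /eqP.
Qed.

Lemma dot_gt0 p (x : 'cV[R]_p) : (0 < dot x x) = (x != 0).
Proof. by rewrite lt_def dot_ge0 andbT dot_eq0. Qed.

(* The reflection exchanging v and the first basis vector e, along w = v - e. *)
Lemma householder p (v : 'cV[R]_(1 + p)) : dot v v = 1 ->
  exists H : 'M[R]_(1 + p),
    [/\ H^T = H, H *m H = 1%:M & H *m delta_mx 0 0 = v].
Proof.
move=> v1; pose e : 'cV[R]_(1 + p) := delta_mx 0 0; pose w := v - e.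
have ee : dot e e = 1.
  rewrite dotE (bigD1 0) //= big1 ?addr0 ?mxE ?eqxx ?mulr1 // => i i0.
  by rewrite mxE (negPf i0) mul0r.
have [/eqP|w0] := eqVneq w 0.
  rewrite subr_eq0 => /eqP ->; exists 1%:M.
  by rewrite trmx1 !mul1mx.
pose c := 2 / dot w w.
(* Both [v] and [e] are unit vectors, so |w|^2 = 2 - 2<e, v>, while <w, e> = <e, v> - 1. *)
have we : dot w e = - (dot w w / 2).
  rewrite /w !(dotDr, dotNr, dotDl, dotNl) (dotC v e) ee v1.
  by move: (dot e v) => d; field.
have wwN0 : dot w w != 0 by rewrite dot_eq0.
exists (1%:M - c *: (w *m w^T)); split.
- by rewrite linearB /= trmx1 linearZ /= trmx_mul trmxK.
- rewrite mulmxBl mul1mx mulmxBr mulmx1.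
  have XX : (w *m w^T) *m (w *m w^T) = dot w w *: (w *m w^T).
    by rewrite -mulmxA (mulmxA w^T) [w^T *m w]mx11_scalar mul_scalar_mx -scalemxAr.
  rewrite -scalemxAl -scalemxAr XX; move: (w *m w^T) => X.
  by apply/matrixP => i j; rewrite !mxE /c; move: (dot w w) (X i j) wwN0 => d y d0; field.
- rewrite mulmxBl mul1mx -scalemxAl -mulmxA -/e.
  rewrite [w^T *m e]mx11_scalar -/(dot w e) mul_mx_scalar scalerA we.
  have -> : c * - (dot w w / 2) = -1.
    by rewrite /c; move: (dot w w) wwN0 => d d0; field.
  by rewrite scaleN1r opprK addrC subrK.
Qed.

(* If u + iw is an eigenvector for a + ib, then <Au, w> = <u, Aw> reads
   b (|u|^2 + |w|^2) = 0. *)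
Lemma symmetric_eigenvector p (A : 'M[R]_p.+1) : A^T = A ->
  exists (a : R) (v : 'cV[R]_p.+1), dot v v = 1 /\ A *m v = a *: v.
Proof.
move=> Asym.
have [z /eigenvalueP [v vA v0]] := @eigenvalue_closed R[i] _ (complexify A) isT.
pose a := complex.Re z; pose b := complex.Im z.
pose u : 'rV[R]_p.+1 := map_mx (@complex.Re R) v.
pose w : 'rV[R]_p.+1 := map_mx (@complex.Im R) v.
(* [vA] relates row vectors; since [A] is symmetric, its real and imaginary parts transpose to
   relations between columns. *)
have uA : A *m u^T = a *: u^T - b *: w^T.
  apply: trmx_inj; rewrite trmx_mul trmxK Asym; apply/rowP => j.
  have /rowP/(_ j) /(congr1 (@complex.Re R)) := vA.
  rewrite !mxE raddf_sum /a /b; case: z {a b vA} => a b.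
  case: (v 0 j) => x y /= <-; apply: eq_bigr => k _.
  by rewrite !mxE; case: (v 0 k) => x' y' /=; rewrite mulr0 subr0.
have wA : A *m w^T = b *: u^T + a *: w^T.
  apply: trmx_inj; rewrite trmx_mul trmxK Asym; apply/rowP => j.
  have /rowP/(_ j) /(congr1 (@complex.Im R)) := vA.
  rewrite !mxE raddf_sum /a /b; case: z {a b uA vA} => a b.
  case: (v 0 j) => x y /=; rewrite [RHS]addrC => <-; apply: eq_bigr => k _.
  by rewrite !mxE; case: (v 0 k) => x' y' /=; rewrite mulr0 add0r.
have b0 : b = 0.
  have : dot (A *m u^T) w^T = dot u^T (A *m w^T) by rewrite dot_mulmxl Asym.
  rewrite uA wA !(dotDl, dotDr, dotNl, dotZl, dotZr) => h.
  have /eqP : b * (dot u^T u^T + dot w^T w^T) = 0 by lra.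
  rewrite mulf_eq0 => /orP [/eqP //|].
  rewrite paddr_eq0 ?dot_ge0 // !dot_eq0 => /andP [/eqP u0 /eqP w0].
  case/negP: v0; apply/eqP/rowP => j; rewrite mxE.
  have /colP /(_ j) := u0; have /colP /(_ j) := w0.
  by rewrite !mxE; case: (v 0 j) => x y /= -> ->.
have [x [x0 Ax]] : exists x : 'cV[R]_p.+1, x != 0 /\ A *m x = a *: x.
  have [u0|u0] := eqVneq u^T 0; last first.
    by exists u^T; rewrite uA b0 scale0r subr0.
  exists w^T; rewrite wA b0 scale0r add0r; split=> //.
  apply: contra v0 => /eqP w0; apply/eqP/rowP => j; rewrite mxE.
  have /colP /(_ j) := u0; have /colP /(_ j) := w0.
  by rewrite !mxE; case: (v 0 j) => x y /= -> ->.
exists a, ((enorm x)^-1 *: x); split; last first.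
  by rewrite -scalemxAr Ax !scalerA mulrC.
rewrite dotZl dotZr mulrA -expr2 exprVn sqr_sqrtr ?dot_ge0 // mulVf //.
by rewrite dot_eq0.
Qed.

(** Deflation by induction on [p]: a reflection [H] takes the first basis vector to a unit
    eigenvector, so [H *m A *m H] is block diagonal with a 1 by 1 block, and symmetry passes to the
    remaining block. *)
Lemma symmetric_spectral p (A : 'M[R]_p) : A^T = A ->
  exists (Q : 'M[R]_p) (d : 'rV[R]_p),
    Q^T *m Q = 1%:M /\ A = Q *m diag_mx d *m Q^T.
Proof.
elim: p A => [|p IHp] A Asym.
  by exists 1%:M, 0; split; apply/matrixP => -[].
have [a [v [v1 Av]]] := symmetric_eigenvector Asym.
have [H [Hsym HH Hv]] := householder v1.
pose e : 'cV[R]_(1 + p) := delta_mx 0 0.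
pose C : 'M[R]_(1 + p) := H *m A *m H.
have Csym : C^T = C by rewrite /C !trmx_mul Hsym Asym mulmxA.
have Ce : C *m e = a *: e.
  by rewrite /C -!mulmxA Hv Av -scalemxAr -Hv mulmxA HH mul1mx.
have AE : A = H *m C *m H.
  by rewrite /C !mulmxA HH mul1mx -mulmxA HH mulmx1.
move: C AE Csym Ce => C AE Csym Ce.
have colE m (M : 'M[R]_(m, 1 + p)) i : (M *m e) i 0 = M i 0.
  by rewrite -colE mxE.
have l0 : lshift p 0 = 0 :> 'I_(1 + p) by apply: val_inj.
have dlC : dlsubmx C = 0.
  apply/matrixP => i j; rewrite !mxE ord1 l0 -colE Ce !mxE.
  by rewrite -(inj_eq val_inj) /= mulr0.
have urC : ursubmx C = 0.
  by rewrite -[ursubmx C]trmxK trmx_ursub Csym dlC trmx0.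
have ulC : ulsubmx C = a%:M.
  rewrite [LHS]mx11_scalar; congr _%:M.
  by rewrite !mxE l0 -colE Ce !mxE eqxx mulr1.
have [|Q [d [QQ CE]]] := IHp (drsubmx C).
  by rewrite trmx_drsub Csym.
pose Q' : 'M[R]_(1 + p) := block_mx 1%:M 0 0 Q.
have Q'Q' : Q'^T *m Q' = 1%:M.
  rewrite /Q' tr_block_mx !trmx0 trmx1 mulmx_block !(mul0mx, mulmx0, mul1mx).
  by rewrite !(addr0, add0r) QQ -scalar_mx_block.
have C_eq : C = Q' *m diag_mx (row_mx a%:M d) *m Q'^T.
  rewrite -[LHS]submxK dlC urC ulC CE diag_mx_row /Q' tr_block_mx !trmx0 trmx1.
  rewrite !mulmx_block !(mul0mx, mulmx0, mul1mx, addr0, add0r, mulmx1).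
  by congr block_mx; apply/matrixP => i j; rewrite !mxE !ord1 !eqxx.
exists (H *m Q'), (row_mx a%:M d); split.
  by rewrite trmx_mul Hsym mulmxA -[_ *m H *m H]mulmxA HH mulmx1.
by rewrite trmx_mul Hsym {1}AE C_eq !mulmxA.
Qed.

End Euclid.

(** * Negative index *)

Section Inertia.
Variable R : realType.

Definition negcount p (d : 'rV[R]_p) : nat := #|[set i | d 0 i < 0]|.

Lemma char_poly_orthodiag p (Q : 'M[R]_p) (d : 'rV[R]_p) : Q^T *m Q = 1%:M ->
  char_poly (Q *m diag_mx d *m Q^T) = \prod_i ('X - (d 0 i)%:P).
Proof.
move=> QQ; have QQ' := mulmx1C QQ.
rewrite /char_poly /char_poly_mx !map_mxM.
have -> : 'X%:M = map_mx polyC Q *m 'X%:M *m map_mx polyC Q^T.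
  by rewrite mul_mx_scalar -scalemxAl -map_mxM QQ' map_mx1 scalemx1.
rewrite -mulmxBl -mulmxBr !det_mulmx mulrAC -det_mulmx -map_mxM QQ'.
rewrite map_mx1 det1 mul1r map_diag_mx -diag_const_mx -raddfB /= det_diag.
by apply: eq_bigr => i _; rewrite !mxE.
Qed.

Lemma nminus_orthodiag p (Q : 'M[R]_p) (d : 'rV[R]_p) : Q^T *m Q = 1%:M ->
  nminus (Q *m diag_mx d *m Q^T) = negcount d.
Proof.
move=> QQ; rewrite /nminus char_poly_orthodiag //.
pose s := [seq d 0 i | i <- enum 'I_p].
have -> : \prod_i ('X - (d 0 i)%:P) = \prod_(y <- s) ('X - y%:P).
  by rewrite big_map big_enum.
set P := \prod_(y <- s) _.
have P0 : P != 0 by rewrite monic_neq0 // monic_prod_XsubC.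
have rsP x : x \in rootsR P = (x \in s).
  by have := roots_on_rootsR P0 x; rewrite root_prod_XsubC in_itv /= => ->.
have rsU : uniq (rootsR P) by exact: uniq_roots.
under eq_bigr => x _ do rewrite mu_prod_XsubC -sum1_count.
(* After the exchange, each diagonal entry contributes once, at the distinct root equal to it. *)
rewrite (exchange_big_dep xpredT) //=.
have -> : negcount d = (\sum_(y <- s) (y < 0)%R)%N.
  rewrite big_map big_enum /= /negcount -sum1dep_card [LHS]big_mkcond /=.
  by apply: eq_bigr => i _; case: ifP.
rewrite big_seq_cond [RHS]big_seq_cond; apply: eq_bigr => y.
rewrite andbT => ys.
rewrite (eq_bigl (fun x => (x == y) && (x < 0))); last first.
  by move=> x; rewrite andbC eq_sym.
by rewrite big_mkcondr -big_filter filter_pred1_uniq ?rsP // big_seq1; case: ifP.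
Qed.

Definition imv p k (M : 'M[R]_(p, k)) : {vspace 'cV[R]_p} :=
  limg (linfun (mulmx M)).

Lemma imvP p k (M : 'M[R]_(p, k)) x :
  reflect (exists y, x = M *m y) (x \in imv M).
Proof.
apply: (iffP memv_imgP) => [[y _ ->]|[y ->]].
  by exists y; rewrite lfunE.
by exists y; rewrite ?memvf // lfunE.
Qed.

Lemma dim_imv p k (M : 'M[R]_(p, k)) :
  (forall y : 'cV[R]_k, M *m y = 0 -> y = 0) -> \dim (imv M) = k.
Proof.
move=> Minj; rewrite limg_dim_eq; first by rewrite dimvf dim_matrix mulr1.
rewrite capfv; apply/eqP; rewrite -subv0; apply/subvP => y.
by rewrite memv_ker lfunE memv0 /= => /eqP /Minj ->.
Qed.

Lemma diag_form p (d : 'rV[R]_p) y :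
  dot (diag_mx d *m y) y = \sum_i d 0 i * (y i 0) ^+ 2.
Proof.
by rewrite dotE; apply: eq_bigr => i _; rewrite mul_diag_mx mxE expr2 mulrA.
Qed.

(** [E] is the embedding of the coordinate subspace of vectors supported on [A]. *)
Lemma mul_colsub_enum_valE p (A : {set 'I_p}) :
  let E : 'M[R]_(p, #|A|) := colsub (@enum_val _ (mem A)) 1%:M in
  forall y : 'cV[R]_#|A|, (forall i, i \notin A -> (E *m y) i 0 = 0) /\
    (forall j, (E *m y) (enum_val j) 0 = y j 0).
Proof.
move=> E y; split=> [i iA|j]; rewrite mxE.
  rewrite big1 // => j _; rewrite !mxE; case: eqP => [ij|]; last by rewrite mul0r.
  by move: iA; rewrite ij enum_valP.
rewrite (bigD1 j) //= big1 ?addr0 ?mxE ?eqxx ?mul1r // => k kj.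
by rewrite !mxE (inj_eq enum_val_inj) eq_sym (negPf kj) mul0r.
Qed.

(** Sylvester's law of inertia. A negative definite subspace meets the span of the coordinates with
    [d] nonnegative only in 0, which bounds its dimension; the span of the coordinates with [d]
    negative attains the bound. *)
Lemma nminus_on_imv p k (B : 'M[R]_p) (P : 'M[R]_(p, k)) (d : 'rV[R]_k) :
    (forall y : 'cV[R]_k, P *m y = 0 -> y = 0) -> P^T *m B *m P = diag_mx d ->
  nminus_on B (imv P) = negcount d.
Proof.
move=> Pinj PBP.
have form y : dot (B *m (P *m y)) (P *m y) = \sum_i d 0 i * (y i 0) ^+ 2.
  by rewrite -diag_form -PBP -!mulmxA [RHS]dot_mulmxl trmxK.
have dimP := dim_imv Pinj.
pose A := [set i | d 0 i < 0].
have E_inj (S : {set 'I_k}) : let E := colsub (@enum_val _ (mem S)) 1%:M in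
    forall y : 'cV[R]_#|S|, P *m E *m y = 0 -> y = 0.
  move=> E y; rewrite -mulmxA => /Pinj Ey; apply/colP => j.
  by rewrite -(mul_colsub_enum_valE y).2 Ey !mxE.
apply/eqP; rewrite eqn_leq; apply/andP; split.
  apply/bigmax_leqP => -[j /= _] /asboolP [W [WV dimW Wneg]].
  pose N := imv (P *m colsub (@enum_val _ (mem (~: A))) 1%:M).
  have dimN : \dim N = #|~: A| by apply: dim_imv; exact: E_inj.
  have NV : (N <= imv P)%VS.
    apply/subvP => x /imvP [y ->]; apply/imvP.
    by rewrite -mulmxA; eexists.
  have WN : (W :&: N = 0)%VS.
    apply/eqP; rewrite -subv0; apply/subvP => x; rewrite memv_cap memv0.
    move=> /andP [xW /imvP [y xE]]; apply: contraT => x0.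
    have := Wneg x xW x0; rewrite xE -mulmxA form ltNge sumr_ge0 // => i _.
    have [iA|iA] := boolP (i \in ~: A).
      by rewrite mulr_ge0 ?sqr_ge0 //; move: iA; rewrite !inE -leNgt.
    by rewrite (mul_colsub_enum_valE y).1 // expr0n mulr0.
  have := dimvS (_ : W + N <= imv P)%VS; rewrite subv_add WV NV => /(_ isT).
  rewrite dimv_disjoint_sum // dimP dimN dimW.
  have := cardsC A; rewrite card_ord => cardA.
  by rewrite -[X in (_ <= X)%N -> _]cardA leq_add2r.
have jlt : (negcount d < (\dim (imv P)).+1)%N.
  by rewrite dimP ltnS -[X in (_ <= X)%N]card_ord max_card.
apply: (@leq_bigmax_cond _ _ _ (Ordinal jlt)); apply/asboolP.
exists (imv (P *m colsub (@enum_val _ (mem A)) 1%:M)); split.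
- apply/subvP => x /imvP [y ->]; apply/imvP.
  by rewrite -mulmxA; eexists.
- by apply: dim_imv; exact: E_inj.
- move=> x /imvP [y ->] x0; rewrite -mulmxA form.
  have le0 i : d 0 i * ((colsub enum_val 1%:M *m y) i 0) ^+ 2 <= 0.
    have [iA|iA] := boolP (i \in A).
      by rewrite mulr_le0_ge0 ?sqr_ge0 // ltW //; move: iA; rewrite inE.
    by rewrite (mul_colsub_enum_valE y).1 // expr0n mulr0.
  rewrite lt_neqAle -oppr_ge0 -sumrN sumr_ge0 ?andbT; last first.
    by move=> i _; rewrite oppr_ge0.
  (* If the form vanishes at [x], each of its nonpositive terms vanishes, and [d] is nonzero on
     [A]. *)
  apply: contra x0; rewrite -oppr_eq0 -sumrN psumr_eq0; last first.
    by move=> i _; rewrite oppr_ge0.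
  move=> /allP h; suff -> : y = 0 by rewrite mulmx0.
  apply/colP => j; rewrite mxE.
  have := h (enum_val j) (mem_index_enum _).
  rewrite oppr_eq0 mulf_eq0 sqrf_eq0 (mul_colsub_enum_valE y).2 => /orP [|/eqP //].
  by have := enum_valP j; rewrite inE => /lt_eqF ->.
Qed.

Lemma imv_full p k (P : 'M[R]_(p, k)) :
  k = p -> (forall y : 'cV[R]_k, P *m y = 0 -> y = 0) -> imv P = fullv.
Proof.
move=> kp Pinj; apply/eqP; rewrite eqEdim subvf (dim_imv Pinj) kp.
by rewrite dimvf dim_matrix mulr1 leqnn.
Qed.

(** The spectral theorem gives one diagonalization by congruence and [P] gives another; both compute
    the index on the full space. The equation [k = p] stays propositional so that [k] can be a sum
    of dimensions. *)
Lemma nminus_congr p k (B : 'M[R]_p) (P : 'M[R]_(p, k)) (d : 'rV[R]_k) :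
    B^T = B -> k = p -> (forall y : 'cV[R]_k, P *m y = 0 -> y = 0) ->
    P^T *m B *m P = diag_mx d ->
  nminus B = negcount d.
Proof.
move=> Bsym kp Pinj PBP.
have [Q [e [QQ BE]]] := symmetric_spectral Bsym.
have Qinj (y : 'cV[R]_p) : Q *m y = 0 -> y = 0.
  by move=> Qy; rewrite -[y]mul1mx -QQ -mulmxA Qy mulmx0.
rewrite -(nminus_on_imv Pinj PBP) (imv_full kp Pinj).
rewrite -(imv_full erefl Qinj) (@nminus_on_imv _ _ _ _ e Qinj).
  by rewrite BE nminus_orthodiag.
by rewrite BE !mulmxA QQ mul1mx -mulmxA QQ mulmx1.
Qed.

Lemma negcount_row_mx p k (d : 'rV[R]_p) (e : 'rV[R]_k) :
  negcount (row_mx d e) = (negcount d + negcount e)%N.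
Proof.
rewrite /negcount -!sum1dep_card !(big_mkcond (fun i => _ < _)) big_split_ord /=.
by congr addn; apply: eq_bigr => i _; rewrite ?row_mxEl ?row_mxEr.
Qed.

(** The sign of the product of the entries is (-1) to the number of negative ones. *)
Lemma odd_negcount p (d : 'rV[R]_p) : 0 < \det (diag_mx d) ->
  odd (negcount d) = false.
Proof.
rewrite det_diag => prod_gt0.
have d0 i : d 0 i != 0.
  by have /prodf_neq0 := lt0r_neq0 prod_gt0; apply.
move: prod_gt0; rewrite -sgr_cp0 (big_morph _ (@sgrM R) (sgr1 R)).
have -> : \prod_i Num.sg (d 0 i) = (-1) ^+ negcount d.
  rewrite -prodr_const [RHS]big_mkcond /=; apply: eq_bigr => i _.
  by rewrite inE sgr_def d0; case: ltP.
by rewrite -signr_odd; case: odd => //; rewrite expr1 eqNr oner_eq0.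
Qed.

(** [eigenvalue] speaks of row vectors; the passage to columns holds because [A] and its transpose
    have the same characteristic polynomial. *)
Lemma eigenvalue_colP (F : fieldType) p (A : 'M[F]_p) a :
  reflect (exists2 x : 'cV[F]_p, A *m x = a *: x & x != 0) (eigenvalue A a).
Proof.
have -> : eigenvalue A a = eigenvalue A^T a.
  rewrite !eigenvalue_root_char /char_poly -[in RHS]det_tr; congr (root (\det _) a).
  by rewrite /char_poly_mx linearB /= tr_scalar_mx map_trmx trmxK.
apply: (iffP eigenvalueP) => -[x Ax x0]; exists x^T.
- by rewrite -[A]trmxK -trmx_mul Ax linearZ.
- by rewrite -trmx0 (inj_eq trmx_inj).
- by rewrite -trmx_mul Ax linearZ.
- by rewrite -trmx0 (inj_eq trmx_inj).
Qed.

(* The characteristic polynomial of -A is monic, has no positive root, and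
   takes the value det A at 0. *)
Lemma det_ge0 p (A : 'M[R]_p) :
    (forall a x, a < 0 -> A *m x = a *: x -> x = 0 :> 'cV[R]_p) -> 0 <= \det A.
Proof.
move=> Aneg; pose f := char_poly (- A).
have f0 : f.[0] = \det A.
  by rewrite horner_coef0 char_poly_det -detZ scaleN1r opprK.
have root_le0 x : root f x -> x <= 0.
  rewrite -eigenvalue_root_char => /eigenvalue_colP [y Ay y0].
  rewrite leNgt; apply/negP => x0; case/negP: y0; apply/eqP.
  apply: (Aneg (- x)); first by rewrite oppr_lt0.
  by rewrite -[A]opprK mulNmx Ay scaleNr.
rewrite -f0 leNgt; apply/negP => lt0.
have lcf : lead_coef f = 1 by apply/eqP; exact: char_poly_monic.
(* For large arguments [f] is at least its leading coefficient 1, so a negative value at 0 would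
   force a positive root. *)
have [|n fn] := @poly_pinfty_gt_lc R f; first by rewrite lcf.
have f_gt0 : 0 < f.[Num.max n 0].
  by apply: lt_le_trans (fn _ _); rewrite ?lcf // le_max lexx.
have [||x] := @poly_ivtoo R f 0 (Num.max n 0).
- by rewrite le_max lexx orbT.
- by rewrite nmulr_rlt0.
- by rewrite in_itv /= => /andP [x0 _] /root_le0; rewrite leNgt x0.
Qed.

(** Antisymmetry gives <Ax, x> = 0, so no nonzero real eigenvalue occurs and [det_ge0] applies. *)
Lemma det_antisym_ge0 p (A : 'M[R]_p) : A^T = - A -> 0 <= \det A.
Proof.
move=> Aanti; apply: det_ge0 => a x a0 Ax.
have : dot (A *m x) x = - dot (A *m x) x.
  by rewrite {1}dot_mulmxl Aanti mulNmx dotNr dotC.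
rewrite Ax dotZl => h; apply/eqP; rewrite -dot_eq0.
have /eqP : a * dot x x = 0 by lra.
by rewrite mulf_eq0 lt_eqF.
Qed.

End Inertia.

(** * Fitting decomposition *)

(** The row spaces of the powers of [A] decrease. Each strict inclusion lowers the rank, so a
    stationary one occurs at some exponent at most [p], and from there on the chain is constant. *)
Lemma submx_expr_stable (F : fieldType) p (A : 'M[F]_p) k l :
  (p <= k)%N -> (A ^+ k <= A ^+ (k + l))%MS.
Proof.
move=> pk.
have stable k' : (exists2 j, (j <= k')%N & (A ^+ j <= A ^+ j.+1)%MS)
    \/ (\rank (A ^+ k') + k' <= p)%N.
  elim: k' => [|k' [[j jk' Aj]|rk]]; first by right; rewrite addn0 rank_leq_row.
    by left; exists j => //; exact: leqW.
  have [AA|AA] := boolP (A ^+ k' <= A ^+ k'.+1)%MS; first by left; exists k'.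
  right; have : (A ^+ k'.+1 < A ^+ k')%MS by rewrite ltmxE AA exprS -mulmxE submxMl.
  move=> /rank_ltmx; rewrite addnS -addSn => rk'.
  by apply: leq_trans rk; rewrite leq_add2r.
have [j jp Aj] : exists2 j, (j <= p)%N & (A ^+ j <= A ^+ j.+1)%MS.
  case: (stable p) => // rk; exists p => //.
  suff -> : A ^+ p = 0 by exact: sub0mx.
  by apply/eqP; rewrite -mxrank_eq0; lia.
have step i : (k <= i)%N -> (A ^+ i <= A ^+ i.+1)%MS.
  (* Right multiplication by A^(i - j) carries the stationary inclusion from exponent j to exponent
     i. *)
  move=> ki; have -> : i = (j + (i - j))%N by lia.
  by rewrite -addSn !exprD -!mulmxE submxMr.
elim: l => [|l IHl]; first by rewrite addn0.
by apply: submx_trans IHl _; rewrite addnS step // leq_addr.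
Qed.

Section Fitting.
Variable R : realType.

Lemma kermx_colE p (A : 'M[R]_p) x : (x \in kermx_col A) = (A *m x == 0).
Proof. by rewrite memv_ker lfunE. Qed.

(** [P0] is a basis of the kernel of A^k and [P1] one of its image. The factorization
    [P1 = A ^+ k *m C] is recorded because it lets A^k be moved across a bilinear form. *)
Lemma fitting p (A : 'M[R]_p) k : (p <= k)%N ->
  exists d0 (P0 : 'M[R]_(p, d0)) d1 (P1 : 'M[R]_(p, d1)) (C : 'M[R]_(p, d1))
      (A1 : 'M[R]_d1),
    [/\ (d0 + d1)%N = p, imv P0 = kermx_col (A ^+ k),
        forall y : 'cV[R]_(d0 + d1), row_mx P0 P1 *m y = 0 -> y = 0,
        P1 = A ^+ k *m C & A *m P1 = P1 *m A1].
Proof.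
(* [kermx] is a left kernel, so the column kernel is obtained by transposing twice. *)
move=> pk; pose K := kermx (A ^+ k)^T.
pose P0 := (row_base K)^T; pose P1 := col_base (A ^+ k).
have [C RC] := row_freeP (row_base_free (A ^+ k)).
have [L0 L0P] : exists L, L *m P0 = 1%:M.
  have [L LP] := row_freeP (row_base_free K); exists L^T.
  by rewrite -trmx_mul LP trmx1.
have [L1 L1P] := row_fullP (col_base_full (A ^+ k)).
have P1E : P1 = A ^+ k *m C by rewrite -[LHS]mulmx1 -RC mulmxA mulmx_base.
have AP0 : A ^+ k *m P0 = 0.
  apply: trmx_inj; rewrite trmx_mul trmxK trmx0; apply/sub_kermxP.
  by rewrite eq_row_base.
(* With A^k = P1 R and R C = 1, the choice A1 = R A C gives P1 A1 = A^k A C = A A^k C = A P1. *)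
exists _, P0, _, P1, C, (row_base (A ^+ k) *m A *m C); split=> //.
- by rewrite mxrank_ker mxrank_tr subnK // rank_leq_row.
- apply/vspaceP => x; rewrite kermx_colE; apply/imvP/eqP => [[y ->]|Ax].
    by rewrite mulmxA AP0 mul0mx.
  have : (x^T <= row_base K)%MS.
    by rewrite eq_row_base; apply/sub_kermxP; rewrite -trmx_mul Ax trmx0.
  move=> /submxP [D xD]; exists D^T.
  by rewrite /P0 -trmx_mul -xD trmxK.
- move=> y; rewrite -[y]vsubmxK mul_row_col => y0.
  have y1 : dsubmx y = 0.
    (* Kernel and image of A^k are independent: A^k = X A^(2k), so A^(2k) C y = 0 implies P1 y = A^k
       C y = 0. *)
    have /submxP [X AX] := submx_expr_stable A k pk.
    have : A ^+ (k + k) *m (C *m dsubmx y) = 0.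
      rewrite exprD -mulmxE -mulmxA [A ^+ k *m (C *m _)]mulmxA -P1E.
      have := congr1 (mulmx (A ^+ k)) y0.
      by rewrite mulmxDr !mulmxA AP0 mul0mx add0r mulmx0.
    move=> /(congr1 (mulmx X)); rewrite mulmx0 !mulmxA -AX -P1E => Py.
    by rewrite -[dsubmx y]mul1mx -L1P -mulmxA Py mulmx0.
  move: y0; rewrite y1 mulmx0 addr0 => P0y.
  by rewrite -[usubmx y]mul1mx -L0P -mulmxA P0y mulmx0 col_mx0.
- rewrite (mulmxA P1 (_ *m A) C) (mulmxA P1 _ A) (mulmx_base (A ^+ k)) P1E.
  by rewrite mulmxA !mulmxE -exprS -exprSr.
Qed.

Lemma det_neq0 p (M : 'M[R]_p) :
  (forall y : 'cV[R]_p, M *m y = 0 -> y = 0) -> \det M != 0.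
Proof.
move=> Minj; rewrite -det_tr; apply/negP => /det0P [v v0 vM].
case/negP: v0; rewrite -(inj_eq trmx_inj) trmx0; apply/eqP/Minj.
by rewrite -[M]trmxK -trmx_mul vM trmx0.
Qed.

(** The parity argument for an abstract complex structure [J]; the spectrum enters only through the
    absence of negative real eigenvalues of [J *m B]. *)
Lemma odd_nminus_gker p (J B : 'M[R]_p) k :
    J^T = - J -> J *m J = - 1%:M -> B^T = B ->
    (forall a x, a < 0 -> J *m B *m x = a *: x -> x = 0 :> 'cV[R]_p) ->
    (p <= k)%N ->
  odd (nminus B) = odd (nminus_on B (kermx_col ((J *m B) ^+ k))).
Proof.
move=> Janti JJ Bsym noneg pk; set A := J *m B.
have BE : B = - (J *m A) by rewrite /A mulmxA JJ mulNmx mul1mx opprK.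
have AJ : A^T *m J = - (J *m A).
  by rewrite -BE /A trmx_mul Bsym Janti mulmxN mulNmx -mulmxA JJ mulmxN mulmx1 opprK.
rewrite -/A in noneg; clearbody A.
(* Skew-adjointness of [A] for the form given by [J], iterated. *)
have AkJ l : J *m A ^+ l = (-1) ^+ l *: ((A ^+ l)^T *m J).
  elim: l => [|l IHl]; first by rewrite expr0 trmx1 mulmx1 mul1mx scale1r.
  rewrite [A ^+ l.+1]exprS -mulmxE mulmxA -[J *m A]opprK -AJ mulNmx -mulmxA IHl.
  rewrite -scalemxAr mulmxA -trmx_mul mulmxE -exprSr -exprS.
  by rewrite [(-1) ^+ l.+1]exprS mulN1r scaleNr.
have [d0 [P0 [d1 [P1 [C [A1 [dd imP0 Pinj P1E AP1]]]]]]] := fitting A pk.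
have AkP0 : A ^+ k *m P0 = 0.
  apply/matrixP => i j; rewrite mxE.
  have : P0 *m delta_mx j 0 \in imv P0 by apply/imvP; eexists.
  rewrite imP0 kermx_colE mulmxA => /eqP /matrixP /(_ i 0).
  by rewrite -colE !mxE.
(* [P1] has a factor A^k on the left; moved across [J], it falls on [P0], which it kills. *)
have P0JP1 : P0^T *m J *m P1 = 0.
  rewrite P1E -mulmxA [J *m (_ *m _)]mulmxA AkJ -scalemxAl -scalemxAr.
  by rewrite !mulmxA -trmx_mul AkP0 trmx0 !mul0mx scaler0.
(* B = -JA and A P1 = P1 A1 reduce orthogonality for [B] to orthogonality for [J]. *)
have P0BP1 : P0^T *m B *m P1 = 0.
  by rewrite BE mulmxN mulNmx -!mulmxA AP1 !mulmxA P0JP1 mul0mx oppr0.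
have P1BP0 : P1^T *m B *m P0 = 0.
  by apply: trmx_inj; rewrite !trmx_mul trmxK Bsym trmx0 mulmxA.
have P1JP0 : P1^T *m J *m P0 = 0.
  apply: trmx_inj; rewrite !trmx_mul trmxK Janti trmx0 mulNmx mulmxN mulmxA.
  by rewrite P0JP1 oppr0.
pose W := - (P1^T *m J *m P1).
have P1inj (y : 'cV[R]_d1) : P1 *m y = 0 -> y = 0.
  move=> Py; have := Pinj (col_mx 0 y); rewrite mul_row_col mulmx0 add0r Py.
  by move=> /(_ erefl); rewrite -col_mx0 => /eq_col_mx [].
have P0inj (y : 'cV[R]_d0) : P0 *m y = 0 -> y = 0.
  move=> Py; have := Pinj (col_mx y 0); rewrite mul_row_col mulmx0 addr0 Py.
  by move=> /(_ erefl); rewrite -col_mx0 => /eq_col_mx [].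
have symB0 : (P0^T *m B *m P0)^T = P0^T *m B *m P0.
  by rewrite !trmx_mul trmxK Bsym mulmxA.
have symB1 : (P1^T *m B *m P1)^T = P1^T *m B *m P1.
  by rewrite !trmx_mul trmxK Bsym mulmxA.
have [Q0 [e0 [QQ0 B0E]]] := symmetric_spectral symB0.
have [Q1 [e1 [QQ1 B1E]]] := symmetric_spectral symB1.
have diagE d (P : 'M[R]_(p, d)) (Q : 'M[R]_d) e : Q^T *m Q = 1%:M ->
    P^T *m B *m P = Q *m diag_mx e *m Q^T ->
    (P *m Q)^T *m B *m (P *m Q) = diag_mx e.
  move=> QQ PBP; rewrite trmx_mul -2!mulmxA [B *m _]mulmxA [P^T *m _]mulmxA.
  by rewrite (mulmxA P^T) PBP !mulmxA QQ mul1mx -mulmxA QQ mulmx1.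
have Qinj d (Q : 'M[R]_d) (y : 'cV[R]_d) : Q^T *m Q = 1%:M -> Q *m y = 0 -> y = 0.
  by move=> QQ Qy; rewrite -[y]mul1mx -QQ -mulmxA Qy mulmx0.
have B1e : P1^T *m B *m P1 = W *m A1.
  by rewrite BE mulmxN !mulNmx -!mulmxA AP1.
have det_gt0 : 0 < \det (diag_mx e1).
  have -> : \det (diag_mx e1) = \det W * \det A1.
    rewrite -det_mulmx -B1e B1E !det_mulmx mulrAC -det_mulmx.
    by rewrite (mulmx1C QQ1) det1 mul1r.
  have W_ge0 : 0 <= \det W.
    apply: det_antisym_ge0.
    by rewrite /W linearN /= !trmx_mul trmxK Janti mulNmx mulmxN mulmxA.
  have A1_ge0 : 0 <= \det A1.
    apply: det_ge0 => a x a0 A1x; apply: P1inj; apply: (noneg _ _ a0).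
    by rewrite mulmxA AP1 -mulmxA A1x scalemxAr.
  (* If W y = 0, then J P1 y is orthogonal to the columns of [P0] and of [P1]; these span the space,
     so it is 0. *)
  have W_neq0 : \det W != 0.
    apply: det_neq0 => y; rewrite /W mulNmx => /eqP; rewrite oppr_eq0 => /eqP P1JPy.
    apply: P1inj; have Jinj : injective (mulmx J : 'cV[R]_p -> 'cV[R]_p).
      move=> u v /(congr1 (mulmx J)); rewrite !mulmxA JJ !mulNmx !mul1mx.
      exact: oppr_inj.
    apply: Jinj; rewrite mulmx0; set x := J *m _.
    have Px : (row_mx P0 P1)^T *m x = 0.
      by rewrite tr_row_mx mul_col_mx /x !mulmxA P0JP1 P1JPy mul0mx col_mx0.
    have : x \in imv (row_mx P0 P1) by rewrite imv_full ?memvf.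
    move=> /imvP [z xE]; apply/eqP; rewrite -dot_eq0 [X in dot X _]xE.
    by rewrite dot_mulmxl Px dotC dot0l.
  have A1_neq0 : \det A1 != 0.
    apply: det_neq0 => y A1y; have APy : A *m (P1 *m y) = 0.
      by rewrite mulmxA AP1 -mulmxA A1y mulmx0.
    (* The kernel of [A] lies in that of A^k only for k > 0; k = 0 forces p = 0, hence d1 = 0. *)
    case: k pk P1E AkP0 imP0 AkJ => [|k] pk _ _ imP0 _.
      have d1_0 : d1 = 0%N by lia.
      by move: (y); rewrite d1_0 => y'; apply/colP => -[].
    have : P1 *m y \in kermx_col (A ^+ k.+1).
      by rewrite kermx_colE exprSr -mulmxE -mulmxA APy mulmx0.
    rewrite -imP0 => /imvP [z Pyz].
    have := Pinj (col_mx (- z) y); rewrite mul_row_col Pyz mulmxN addNr.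
    by move=> /(_ erefl); rewrite -col_mx0 => /eq_col_mx [].
  by rewrite lt_def mulf_neq0 // mulr_ge0.
pose P := row_mx (P0 *m Q0) (P1 *m Q1).
have PBP : P^T *m B *m P = diag_mx (row_mx e0 e1).
  rewrite /P tr_row_mx mul_col_mx mul_col_row.
  rewrite (diagE _ _ _ _ QQ0 B0E) (diagE _ _ _ _ QQ1 B1E) diag_mx_row.
  congr block_mx.
    rewrite trmx_mul -!mulmxA (mulmxA B) !(mulmxA P0^T).
    by rewrite P0BP1 mul0mx mulmx0.
  rewrite trmx_mul -!mulmxA (mulmxA B) !(mulmxA P1^T).
  by rewrite P1BP0 mul0mx mulmx0.
have P'inj (y : 'cV[R]_(d0 + d1)) : P *m y = 0 -> y = 0.
  rewrite -[y]vsubmxK /P mul_row_col -!mulmxA -mul_row_col => /Pinj.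
  rewrite -[RHS]col_mx0 => /eq_col_mx [].
  by move=> /(Qinj _ _ _ QQ0) -> /(Qinj _ _ _ QQ1) ->; rewrite col_mx0.
rewrite (nminus_congr Bsym dd P'inj PBP) negcount_row_mx oddD.
rewrite (odd_negcount det_gt0) addbF.
rewrite -imP0.
have -> : imv P0 = imv (P0 *m Q0).
  apply/vspaceP => x; apply/imvP/imvP => -[y ->].
    by exists (Q0^T *m y); rewrite -mulmxA (mulmxA Q0) (mulmx1C QQ0) mul1mx.
  by exists (Q0 *m y); rewrite mulmxA.
rewrite (@nminus_on_imv _ _ _ _ _ e0) //; last exact: diagE.
by move=> y; rewrite -mulmxA => /P0inj /(Qinj _ _ _ QQ0).
Qed.

End Fitting.

(** * Jordan blocks for the zero eigenvalue *)

Section Jordan.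
Variable R : realType.

Lemma det_jordan_block (a : R[i]) s : \det (jordan_block a s) = a ^+ s.
Proof.
rewrite -det_tr det_trig; last first.
  apply/is_trig_mxP => i j ij; rewrite !mxE.
  rewrite (gtn_eqF (leqW ij)) addr0; case: eqP => // ji.
  by move: ij; rewrite ji ltnn.
rewrite -[s in RHS]card_ord -prodr_const; apply: eq_bigr => i _.
by rewrite !mxE eqxx (gtn_eqF (ltnSn i)) addr0.
Qed.

Lemma mul_mxdiag (T : pzSemiRingType) r (s : 'I_r -> nat)
    (D E : forall i, 'M[T]_(s i)) :
  (\mxdiag_i D i) *m (\mxdiag_i E i) = \mxdiag_i (D i *m E i).
Proof.
rewrite {2 3}/mxdiag mul_mxdiag_mxblock; apply/eq_mxblock => i j.
by case: eqVneq => [<-|_]; rewrite ?conform_mx_id ?mulmx0.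
Qed.

(* Every block is invertible or zero; invmx D *m D *m D = D holds in both cases,
   since invmx D is D when D is singular. *)
Lemma simple_zero_jordan_form p (A : 'M[R[i]]_p) r (a : 'I_r -> R[i]) s :
    is_jordan_form A a s -> (forall i, a i = 0 -> s i = 1%N) ->
  exists X, A = X *m A *m A.
Proof.
move=> [_ [P [Pfree Pfull AP]]] s1.
pose D i := jordan_block (a i) (s i).
have DE i : D i = invmx (D i) *m D i *m D i.
  have [a0|a0] := eqVneq (a i) 0.
    suff -> : D i = 0 by rewrite mulmx0.
    apply/matrixP => j k; rewrite !mxE a0 mul0rn add0r.
    have si := s1 i a0; have := ltn_ord j; have := ltn_ord k.
    by rewrite [X in (_ < X)%N -> _]si [X in _ -> (_ < X)%N -> _]si; case: eqP => //; lia.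
  by rewrite mulVmx ?mul1mx // unitmxE det_jordan_block unitfE expf_neq0.
have [Q PQ] := row_freeP Pfree; have [Q' Q'P] := row_fullP Pfull.
(* [P] is formally rectangular, so its right inverse is shown to be a left inverse by comparison
   with [Q']. *)
have QP : Q *m P = 1%:M by rewrite -Q'P -[Q]mul1mx -Q'P -(mulmxA _ P) PQ mulmx1.
pose M := \mxdiag_i D i; pose N := \mxdiag_i invmx (D i).
have ME : M = N *m M *m M by rewrite !mul_mxdiag; exact: eq_mxdiag.
have AE : A = P *m M *m Q by rewrite -AP -mulmxA PQ mulmx1.
exists (P *m N *m Q); rewrite AE !mulmxA.
rewrite -[_ *m Q *m P]mulmxA QP mulmx1 -[_ *m Q *m P]mulmxA QP mulmx1.
by rewrite {1}ME !mulmxA.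
Qed.

(** A factorization A = X A A makes A A y = 0 imply A y = 0, which lowers the exponent one step at a
    time. *)
Lemma ker_expr_simple p (A : 'M[R]_p) k (x : 'cV[R]_p) :
    no_nontrivial_zero_jordan_block A -> (0 < k)%N ->
  A ^+ k *m x = 0 -> A *m x = 0.
Proof.
move=> [r [a [s [AJ s1]]]] k_gt0.
have [X AX] := simple_zero_jordan_form AJ s1.
have AA (y : 'cV[R]_p) : A *m (A *m y) = 0 -> A *m y = 0.
  move=> AAy; apply: (@map_mx_inj _ _ (real_complex R)).
  rewrite map_mxM -/(complexify A) AX -!mulmxA.
  have -> : complexify A *m (complexify A *m map_mx (real_complex R) y) = 0.
    by rewrite -!map_mxM AAy map_mx0.
  by rewrite map_mx0 mulmx0.
case: k k_gt0 => // k _; elim: k x => [|k IHk] x; first by rewrite expr1.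
by rewrite exprSr -mulmxE -mulmxA => /IHk /AA.
Qed.

Lemma nminus_on_null p (B : 'M[R]_p) (V : {vspace 'cV[R]_p}) :
  (forall x, x \in V -> B *m x = 0) -> nminus_on B V = 0%N.
Proof.
move=> BV; apply/eqP; rewrite -leqn0.
apply/bigmax_leqP => -[j /= _] /asboolP [W [WV <- Wneg]].
suff -> : W = 0%VS by rewrite dimv0.
apply/eqP; rewrite -subv0; apply/subvP => x xW; rewrite memv0.
apply: contraT => x0; have := Wneg x xW x0.
by rewrite BV ?(subvP WV) // dot0l ltxx.
Qed.

End Jordan.

(** * Symmetry of the Hessian of the potential *)

Section Hessian.
Local Open Scope classical_set_scope.
Variable R : realType.

(** Along a line in configuration space, the squared distance of two bodies is such a polynomial. *)
Lemma is_derive_quad (a b c t : R) :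
  is_derive t 1 (fun s : R => a + s * b + s ^+ 2 * c) (b + 2 * t * c).
Proof.
apply: is_derive_eq.
by rewrite /GRing.scale /=; ring.
Qed.

Lemma is_derive_big (I : Type) (r : seq I) (P : pred I) (f : I -> R -> R)
    (df : I -> R) (t : R) :
  (forall i, P i -> is_derive t 1 (f i) (df i)) ->
  is_derive t 1 (fun s => \sum_(i <- r | P i) f i s) (\sum_(i <- r | P i) df i).
Proof.
move=> h; elim: r => [|i r IHr].
  under eq_fun do rewrite big_nil; rewrite big_nil; exact: is_derive_cst.
under eq_fun do rewrite big_cons; rewrite big_cons.
case: ifP => // Pi; apply: is_deriveD => //.
exact: h.
Qed.

Lemma is_derive_ext (f g : R -> R) (t df : R) :
  f =1 g -> is_derive t 1 f df -> is_derive t 1 g df.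
Proof. by move=> /funext ->. Qed.

(** This differentiates the contribution of one pair of bodies to the potential along a line. *)
Lemma is_derive_inv_sqrt (a b c : R) : 0 < a ->
  is_derive (0 : R) 1 (fun s : R => (Num.sqrt (a + s * b + s ^+ 2 * c))^-1)
    (- (b / 2) / Num.sqrt a ^+ 3).
Proof.
move=> a0; have aE : a + 0 * b + 0 ^+ 2 * c = a by rewrite mul0r expr0n mul0r !addr0.
have sa0 : Num.sqrt a != 0 by rewrite gt_eqF // sqrtr_gt0.
have dsqrt : is_derive (0 : R) 1 (fun s : R => Num.sqrt (a + s * b + s ^+ 2 * c))
    (b / (2 * Num.sqrt a)).
  have -> : b / (2 * Num.sqrt a)
      = (b + 2 * 0 * c) * (2 * Num.sqrt (a + 0 * b + 0 ^+ 2 * c))^-1.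
    by rewrite aE mulr0 mul0r addr0.
  rewrite mulrC; apply: (@is_derive1_comp _ Num.sqrt _ 0).
    by apply: is_derive1_sqrt; rewrite aE.
  exact: is_derive_quad.
apply: is_derive_eq.
  by apply: is_deriveV dsqrt; rewrite aE.
rewrite /= aE /GRing.scale /=; move: (Num.sqrt a) sa0 => r r0.
by field.
Qed.

(** This differentiates one summand of a first partial along a line: [p + s * r] is the inner
    product of the moving separation with a fixed vector. *)
Lemma is_derive_inv_sqrt3 (a b c p r : R) : 0 < a ->
  is_derive (0 : R) 1
    (fun s : R => - (p + s * r) / Num.sqrt (a + s * b + s ^+ 2 * c) ^+ 3)
    (- r / Num.sqrt a ^+ 3 + 3 * p * (b / 2) / Num.sqrt a ^+ 5).
Proof.
move=> a0; have aE : a + 0 * b + 0 ^+ 2 * c = a by rewrite mul0r expr0n mul0r !addr0.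
have sa0 : Num.sqrt a != 0 by rewrite gt_eqF // sqrtr_gt0.
have h := is_derive_inv_sqrt b c a0.
under eq_fun do rewrite -exprVn.
have lin : is_derive (0 : R) 1 (fun s : R => - (p + s * r)) (- r).
  by apply: is_derive_eq; rewrite /GRing.scale /=; ring.
apply: is_derive_eq; rewrite /= aE /GRing.scale /=.
by move: (Num.sqrt a) sa0 => x x0; field.
Qed.

Variables (n : nat) (m : 'I_n -> R).
Implicit Types x y : 'cV[R]_(cdim n).

Definition sep x i j : 'cV[R]_2 := pos x i - pos x j.

Lemma sep_line x y t i j : sep (x + t *: y) i j = sep x i j + t *: sep y i j.
Proof. by apply/colP => k; rewrite !mxE; ring. Qed.

Lemma dot_line d (x y : 'cV[R]_d) t :
  dot (x + t *: y) (x + t *: y) = dot x x + t * (2 * dot x y) + t ^+ 2 * dot y y.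
Proof.
rewrite !(dotDl, dotDr, dotZl, dotZr) (dotC y x).
by move: (dot x x) (dot x y) (dot y y) => a b c; ring.
Qed.

Definition collision_free x := forall i j, i != j -> pos x i != pos x j.

Lemma sep_gt0 x (i j : 'I_n) :
  collision_free x -> (i < j)%N -> 0 < dot (sep x i j) (sep x i j).
Proof.
move=> xfree ij; rewrite dot_gt0 subr_eq0 xfree //.
by apply: contraTneq ij => ->; rewrite ltnn.
Qed.

Let basis a : 'cV[R]_(cdim n) := delta_mx a 0.

Lemma partial_potential x a : collision_free x ->
  partial (potential m) a x = \sum_(i < n) \sum_(j < n | (i < j)%N) m i * m j *
    (- dot (sep x i j) (sep (basis a) i j) / enorm (sep x i j) ^+ 3).
Proof.
move=> xfree; rewrite /partial derive1E; apply: derive_val.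
apply: is_derive_big => i _; apply: is_derive_big => j ij.
have h := is_derive_inv_sqrt (2 * dot (sep x i j) (sep (basis a) i j))
  (dot (sep (basis a) i j) (sep (basis a) i j)) (sep_gt0 xfree ij).
apply: is_derive_ext (is_derive_eq (is_deriveZ (m i * m j) h) _) => [t|]; last first.
  by rewrite mulrAC divff ?pnatr_eq0 // mul1r.
by rewrite -[pos _ i - _]/(sep _ i j) /enorm sep_line dot_line.
Qed.

(** Squared distances are continuous and there are finitely many pairs. Openness is needed because a
    second derivative uses the first partials on a whole neighbourhood. *)
Lemma near_collision_free x y : collision_free x ->
  \forall t \near (0 : R), collision_free (x + t *: y).
Proof.
move=> xfree.
have H (i j : 'I_n) : \forall t \near (0 : R), i != j ->
    0 < dot (sep (x + t *: y) i j) (sep (x + t *: y) i j).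
  have [ij|ij] := boolP (i == j); first by near=> t.
  have d := is_derive_quad (dot (sep x i j) (sep x i j))
    (2 * dot (sep x i j) (sep y i j)) (dot (sep y i j) (sep y i j)) 0.
  have /derivable1_diffP/differentiable_continuous c := @ex_derive _ _ _ _ _ _ _ d.
  have := cvgr_gt _ c 0; rewrite /= mul0r expr0n mul0r !addr0 dot_gt0 subr_eq0.
  move=> /(_ _ (xfree _ _ ij)); apply: filterS => t t_gt0 _.
  by rewrite sep_line dot_line.
have : \forall t \near (0 : R), forall i j : 'I_n, i != j ->
    0 < dot (sep (x + t *: y) i j) (sep (x + t *: y) i j).
  exact: filter_forall (fun i => filter_forall _ (H i)).
apply: filterS => t h i j ij; have := h i j ij.
by rewrite dot_gt0 subr_eq0.
Unshelve. all: by end_near. Qed.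

(** Differentiating the explicit first partials once more yields summands visibly symmetric in [a]
    and [b]. *)
Lemma hessE x a b : collision_free x ->
  hess (potential m) x a b = \sum_(i < n) \sum_(j < n | (i < j)%N) m i * m j *
    (- dot (sep (basis a) i j) (sep (basis b) i j) / enorm (sep x i j) ^+ 3
     + 3 * dot (sep x i j) (sep (basis b) i j) * dot (sep x i j) (sep (basis a) i j)
       / enorm (sep x i j) ^+ 5).
Proof.
move=> xfree; rewrite mxE {1}/partial derive1E; apply: derive_val.
pose f t := \sum_(i < n) \sum_(j < n | (i < j)%N) m i * m j *
    (- dot (sep (x + t *: basis a) i j) (sep (basis b) i j)
     / enorm (sep (x + t *: basis a) i j) ^+ 3).
apply: (@near_eq_is_derive _ _ _ f).
  near=> t; rewrite partial_potential //.
  by near: t; exact: near_collision_free.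
apply: is_derive_big => i _; apply: is_derive_big => j ij.
have h := is_derive_inv_sqrt3 (2 * dot (sep x i j) (sep (basis a) i j))
  (dot (sep (basis a) i j) (sep (basis a) i j))
  (dot (sep x i j) (sep (basis b) i j))
  (dot (sep (basis a) i j) (sep (basis b) i j)) (sep_gt0 xfree ij).
apply: is_derive_ext (is_derive_eq (is_deriveZ (m i * m j) h) _) => [t|]; last first.
  by rewrite [2 * _ / 2]mulrAC divff ?pnatr_eq0 // mul1r.
rewrite /= sep_line dotDl dotZl /enorm dot_line //.
Unshelve. all: by end_near. Qed.

Lemma tr_hess x : collision_free x -> (hess (potential m) x)^T = hess (potential m) x.
Proof.
move=> xfree; apply/matrixP => a b; rewrite mxE !hessE //.
apply: eq_bigr => i _; apply: eq_bigr => j _.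
by rewrite (dotC (sep (basis b) i j)) [3 * _ * _]mulrAC.
Qed.

End Hessian.

(** * Parity of the index *)

Section B3.
Variable R : realType.

Lemma tr_Jstd p : (Jstd R p)^T = - Jstd R p.
Proof.
rewrite /Jstd tr_block_mx !trmx0 linearN /= trmx1 opp_block_mx !oppr0 opprK.
by [].
Qed.

Lemma Jstd_sqr p : Jstd R p *m Jstd R p = - 1%:M.
Proof.
rewrite /Jstd mulmx_block !mul0mx !mulmx0 !mul1mx !add0r !addr0 mulmx1.
by rewrite scalar_mx_block opp_block_mx !oppr0.
Qed.

Variables (n : nat) (m : 'I_n -> R).

Lemma tr_blockdiag (A : 'I_n -> 'M[R]_2) :
  (blockdiag A)^T = blockdiag (fun i => (A i)^T).
Proof. exact: tr_mxdiag. Qed.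

Lemma tr_K_mx q : (K_mx m q)^T = - K_mx m q.
Proof.
rewrite tr_blockdiag /K_mx /blockdiag -mxdiagN; apply: eq_mxdiag => i.
by rewrite linearZ -scalerN; congr (_ *: _); apply/matrixP => a b; rewrite !mxE opprB.
Qed.

Lemma tr_mass_mx : (mass_mx m)^T = mass_mx m.
Proof.
by rewrite tr_blockdiag; apply: eq_mxdiag => i; rewrite linearZ /= trmx1.
Qed.

(** The product has diagonal blocks -D^2U and M^-1 and off-diagonal blocks -K and K, with K
    antisymmetric. *)
Lemma tr_Jstd_L_mx q : collision_free q ->
  (Jstd R (cdim n) *m L_mx m q)^T = Jstd R (cdim n) *m L_mx m q.
Proof.
move=> qfree; rewrite /Jstd /L_mx mulmx_block !mul0mx !mul1mx !add0r !addr0.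
rewrite !mulNmx !mul1mx tr_block_mx !linearN /= tr_hess // tr_K_mx opprK trmx_inv.
by rewrite tr_mass_mx.
Qed.

(** In a symplectic basis, J L3 = S^T J S L3 = S^T (J L) S, a congruence of a symmetric matrix. *)
Lemma tr_B3 q B : collision_free q -> is_B3 m q B -> B^T = B.
Proof.
move=> qfree [S [L3 [[_ SJS] LS ->]]].
have -> : Jstd R (hdim n) *m L3 = S^T *m (Jstd R (cdim n) *m L_mx m q) *m S.
  by rewrite -SJS -!mulmxA LS.
by rewrite trmx_mul [(S^T *m _)^T]trmx_mul trmxK tr_Jstd_L_mx // !mulmxA.
Qed.

End B3.

Theorem theorem1p3 (R : realType) (n : nat) (m : 'I_n -> R)
    (q : 'cV[R]_(cdim n)) (gamma : R -> 'cV[R]_(cdim n))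
    (B3 : 'M[R]_(hdim n + hdim n))
    (hn : (3 <= n)%N) (hm : forall i, 0 < m i)
    (hgamma : is_circular_RE m q gamma) (hB3 : is_B3 m q B3) :
  (((nminus_on B3 (kermx_col ((Jstd R (hdim n) *m B3) ^+ (4 * n - 8))))%:Z
      - (nminus B3)%:Z = 1 %[mod 2])%Z ->
   spectrally_unstable m gamma) /\
  (no_nontrivial_zero_jordan_block (Jstd R (hdim n) *m B3) ->
   (nminus B3 = 1 %[mod 2])%N ->
   spectrally_unstable m gamma).
Proof.
have [[qfree _ _ _] _] := hgamma.
have parity : spectrally_stable m gamma -> odd (nminus B3)
    = odd (nminus_on B3 (kermx_col ((Jstd R (hdim n) *m B3) ^+ (4 * n - 8)))).
  move=> stable; apply: odd_nminus_gker.
  - exact: tr_Jstd.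
  - exact: Jstd_sqr.
  - exact: tr_B3 qfree hB3.
  (* A real eigenvalue is its own real part, which stability makes zero, so it cannot be
     negative. *)
  - move=> a x a0 Ax; apply: contraTeq a0 => x0.
    have -> : a = complex.Re (real_complex R a) by [].
    rewrite (stable q B3 hgamma hB3) ?ltxx //.
    apply/eigenvalue_colP; exists (map_mx (real_complex R) x).
      by rewrite -map_mxM Ax map_mxZ.
    by rewrite map_mx_eq0.
  - by rewrite /hdim; lia.
split=> [mod1 /parity|simple0 odd_n /parity].
  by move: (nminus_on _ _) (nminus _) mod1 => a b; lia.
rewrite nminus_on_null => [|x]; first by lia.
rewrite kermx_colE => /eqP /(ker_expr_simple simple0) Ax.
(* Since J^2 = -1, the kernel of J B lies in that of B. The exponent 4n - 8 is positive because n is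
   at least 3, as the descent of kernels requires. *)
have -> : B3 *m x = - (Jstd R _ *m (Jstd R _ *m B3 *m x)).
  by rewrite !mulmxA Jstd_sqr !mulNmx mul1mx opprK.
by rewrite Ax ?mulmx0 ?oppr0 //; lia.
Qed.
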